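(* Over $\mathbf{CZF}_0$, the General Uniformity Principle implies that the only injective sets are the singletons; that is, a set $E$ is injective if and only if $E=\{s\}$ for some $s$.
   Context: $\mathbf{CZF}_0$ is the theory in intuitionistic first-order logic with equality, in the language of set theory ($\in$, $=$), with the axioms: extensionality; pairing; union; replacement (for arbitrary formulas); restricted separation (separation for $\Delta_0$-formulas only, i.e. formulas in which all quantifiers are bounded by sets); strong infinity (there is a least inductive set $\mathbb{N}$); mathematical induction on $\mathbb{N}$ for arbitrary formulas. There is no power set axiom and no excluded middle. Maps between sets are sets. The General Uniformity Principle is the scheme: for every formula $\varphi(x,y)$ (parameters allowed) and every set $a$, $$\forall x\,\exists y\in a\;\varphi(x,y)\;\rightarrow\;\exists y\in a\,\forall x\;\varphi(x,y),$$ where $x$ ranges over the universe of all sets. A set $E$ is injective if every map with codomain $E$ can be extended to any superset of its domain: for all sets $X\subseteq Y$ and every map $f:X\to E$ there is a map $g:Y\to E$ with $g|_X=f$. *)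

(* Defs.v *)
From Stdlib Require Import List.
Import ListNotations.

(** The set theory is deeply embedded: its formulas are data and "the theory
    proves" is derivability in intuitionistic natural deduction.  Interpreting
    the axioms directly in [Prop] would not do, since the General Uniformity
    Principle is refutable as soon as excluded middle is available.

    The language has no function symbols, so terms are just variables, written
    as de Bruijn indices. *)

Inductive form : Type :=
| Mem (i j : nat)
| Eq (i j : nat)
| Bot
| And (A B : form)
| Or (A B : form)
| Imp (A B : form)
| All (A : form)
| Ex (A : form).

Definition Neg (A : form) : form := Imp A Bot.
Definition Iff (A B : form) : form := And (Imp A B) (Imp B A).

Declare Scope form_scope.
Delimit Scope form_scope with form.
Bind Scope form_scope with form.
Notation "i ∈ j" := (Mem i j) (at level 70) : form_scope.
Notation "i ≐ j" := (Eq i j) (at level 70) : form_scope.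
Notation "~ A" := (Neg A) : form_scope.
Notation "A /\ B" := (And A B) : form_scope.
Notation "A \/ B" := (Or A B) : form_scope.
Notation "A --> B" := (Imp A B) (at level 99, right associativity) : form_scope.
Notation "A <-> B" := (Iff A B) : form_scope.
Local Open Scope form_scope.

(** As terms are variables, substitutions are the same thing as renamings. *)

Definition scons (i : nat) (r : nat -> nat) (n : nat) : nat :=
  match n with 0 => i | S m => r m end.
Notation "i .: r" := (scons i r) (at level 55, right associativity).

Fixpoint ren (r : nat -> nat) (A : form) : form :=
  match A with
  | i ∈ j => r i ∈ r j
  | i ≐ j => r i ≐ r j
  | Bot => Bot
  | A /\ B => ren r A /\ ren r B
  | A \/ B => ren r A \/ ren r B
  | A --> B => ren r A --> ren r B
  | All A => All (ren (0 .: fun n => S (r n)) A)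
  | Ex A => Ex (ren (0 .: fun n => S (r n)) A)
  end.

Definition inst (i : nat) (A : form) : form := ren (i .: fun n => n) A.
Definition lift (A : form) : form := ren S A.

Reserved Notation "T ;; G ⊢ A" (at level 75, G at level 74, A at level 74).

(** Members of [T] may be used in any context and are not lifted in [AllI] and
    [ExE]; hence an axiom with free variables is understood as its universal
    closure.  Hypotheses in [G] are handled as usual: their free variables are
    held fixed. *)

Inductive prv (T : form -> Prop) : list form -> form -> Prop :=
| Axm G A : T A -> T ;; G ⊢ A
| Hyp G A : In A G -> T ;; G ⊢ A
| BotE G A : T ;; G ⊢ Bot -> T ;; G ⊢ A
| AndI G A B : T ;; G ⊢ A -> T ;; G ⊢ B -> T ;; G ⊢ (A /\ B)
| AndE1 G A B : T ;; G ⊢ (A /\ B) -> T ;; G ⊢ A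
| AndE2 G A B : T ;; G ⊢ (A /\ B) -> T ;; G ⊢ B
| OrI1 G A B : T ;; G ⊢ A -> T ;; G ⊢ (A \/ B)
| OrI2 G A B : T ;; G ⊢ B -> T ;; G ⊢ (A \/ B)
| OrE G A B C : T ;; G ⊢ (A \/ B) -> T ;; (A :: G) ⊢ C ->
    T ;; (B :: G) ⊢ C -> T ;; G ⊢ C
| ImpI G A B : T ;; (A :: G) ⊢ B -> T ;; G ⊢ (A --> B)
| ImpE G A B : T ;; G ⊢ (A --> B) -> T ;; G ⊢ A -> T ;; G ⊢ B
| AllI G A : T ;; (map lift G) ⊢ A -> T ;; G ⊢ (All A)
| AllE G A i : T ;; G ⊢ (All A) -> T ;; G ⊢ (inst i A)
| ExI G A i : T ;; G ⊢ (inst i A) -> T ;; G ⊢ (Ex A)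
| ExE G A C : T ;; G ⊢ (Ex A) -> T ;; (A :: map lift G) ⊢ (lift C) ->
    T ;; G ⊢ C
| EqRefl G i : T ;; G ⊢ (i ≐ i)
| EqSubst G i j A : T ;; G ⊢ (i ≐ j) -> T ;; G ⊢ (inst i A) ->
    T ;; G ⊢ (inst j A)
where "T ;; G ⊢ A" := (prv T G A).

Definition provable (T : form -> Prop) (A : form) : Prop := T ;; [] ⊢ A.

(** In everything below, the numeric arguments of a defined formula are the
    variables it speaks about. *)

Definition BAll (a : nat) (A : form) : form := All (0 ∈ S a --> A).
Definition BEx (a : nat) (A : form) : form := Ex (0 ∈ S a /\ A).

(** The bounding variable [a] is read outside the quantifier, so it never is
    the bound variable itself. *)

Inductive Delta0 : form -> Prop :=
| D0Mem i j : Delta0 (i ∈ j)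
| D0Eq i j : Delta0 (i ≐ j)
| D0Bot : Delta0 Bot
| D0And A B : Delta0 A -> Delta0 B -> Delta0 (A /\ B)
| D0Or A B : Delta0 A -> Delta0 B -> Delta0 (A \/ B)
| D0Imp A B : Delta0 A -> Delta0 B -> Delta0 (A --> B)
| D0All a A : Delta0 A -> Delta0 (BAll a A)
| D0Ex a A : Delta0 A -> Delta0 (BEx a A).

(** Unique existence in variable [0]. *)
Definition ExUniq (A : form) : form :=
  Ex (A /\ All (ren (0 .: fun n => 2 + n) A --> 0 ≐ 1)).

Definition subset (x y : nat) : form := BAll x (0 ∈ S y).
Definition empty (x : nat) : form := All (~ (0 ∈ S x)).
Definition singleton (x s : nat) : form := All (0 ∈ S x <-> 0 ≐ S s).
Definition upair (p x y : nat) : form :=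
  All (0 ∈ S p <-> (0 ≐ S x \/ 0 ≐ S y)).

(** [y] is [x ∪ {x}]. *)
Definition succ (y x : nat) : form :=
  All (0 ∈ S y <-> (0 ∈ S x \/ 0 ≐ S x)).

Definition inductive (n : nat) : form :=
  BEx n (empty 0) /\ BAll n (BEx (S n) (succ 0 1)).
Definition least_inductive (n : nat) : form :=
  inductive n /\ All (inductive 0 --> subset (S n) 0).

(** [p] is the Kuratowski pair [{{x}, {x, y}}]. *)
Definition opair (p x y : nat) : form :=
  All (0 ∈ S p <-> (singleton 0 (S x) \/ upair 0 (S x) (S y))).

(** The map [f] sends [x] to [y]. *)
Definition sends (f x y : nat) : form := BEx f (opair 0 (S x) (S y)).

(** [f] is a map from [x] to [e]. *)
Definition is_map (f x e : nat) : form :=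
  BAll f (BEx (S x) (BEx (2 + e) (opair 2 1 0))) /\
  BAll x (ExUniq (sends (2 + f) 1 0)).

(** [f] is the restriction of [g] to [x]. *)
Definition is_restriction (f g x : nat) : form :=
  All (0 ∈ S f <-> (0 ∈ S g /\ BEx (S x) (Ex (opair 2 1 0)))).

(** Binders, outermost first: the sets [X], [Y], then [f : X -> e] and its
    extension [g : Y -> e]. *)
Definition injective (e : nat) : form :=
  All (All (subset 1 0 -->
    All (is_map 0 2 (3 + e) -->
      Ex (is_map 0 2 (4 + e) /\ is_restriction 1 0 3)))).

Definition extensionality : form :=
  All (All (All (0 ∈ 2 <-> 0 ∈ 1) --> 1 ≐ 0)).
Definition pairing : form := All (All (Ex (upair 0 2 1))).
Definition union : form :=
  All (Ex (All (0 ∈ 1 <-> BEx 2 (1 ∈ 0)))).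

(** [A] is [phi(x, y)] with variable [0] for [y], variable [1] for [x], and
    parameters from [2] on. *)
Definition replacement (a : nat) (A : form) : form :=
  BAll a (ExUniq A) -->
  Ex (All (0 ∈ 1 <-> BEx (2 + a) (ren (1 .: 0 .: fun n => 3 + n) A))).

(** [A] is [phi(x)] with variable [0] for [x]; the shift keeps the set being
    defined out of [phi]. *)
Definition separation (a : nat) (A : form) : form :=
  Ex (All (0 ∈ 1 <-> (0 ∈ 2 + a /\ ren (0 .: fun n => 2 + n) A))).

Definition strong_infinity : form := Ex (least_inductive 0).

(** [A] is [phi(x)] with variable [0] for [x]; variable [n] is the least
    inductive set. *)
Definition induction (n : nat) (A : form) : form :=
  least_inductive n -->
  (All (empty 0 --> A) /\
   BAll n (A --> All (succ 0 1 --> ren (0 .: fun k => 2 + k) A))) -->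
  BAll n A.

Inductive CZF0 : form -> Prop :=
| CZF0_ext : CZF0 extensionality
| CZF0_pair : CZF0 pairing
| CZF0_union : CZF0 union
| CZF0_repl a A : CZF0 (replacement a A)
| CZF0_sep a A : Delta0 A -> CZF0 (separation a A)
| CZF0_inf : CZF0 strong_infinity
| CZF0_mathind n A : CZF0 (induction n A).

(** [A] is [phi(x, y)] with variable [0] for [y] and variable [1] for [x]; on
    the right the two quantifiers, hence the two variables, are exchanged. *)
Definition uniformity (a : nat) (A : form) : form :=
  All (BEx (S a) A) -->
  BEx a (All (ren (1 .: 0 .: fun n => 2 + n) A)).

Inductive GUP : form -> Prop :=
| GUP_inst a A : GUP (uniformity a A).

Definition extend (T U : form -> Prop) (A : form) : Prop := (T A \/ U A)%type.

(* Main.v *)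
(** If [E] is injective and [a, b ∈ E], then for every set [x] the partial map
    on [{∅}] sending [∅] to [a] if [∅ ∈ x] and to [b] if [∅ ∉ x] extends to
    [{∅}]; the value of the extension is a [y ∈ E] with [∅ ∈ x -> y = a] and
    [∅ ∉ x -> y = b].  By uniformity one [y] serves all [x], and [x = {∅}] and
    [x = ∅] give [a = y = b].  An element of [E] is obtained by extending the
    empty map to [{∅}].

    Derivations are carried out in natural deduction with eigenvariables
    replaced by quantification over all variables in the metatheory, so that
    contexts only ever grow and are never lifted. *)

Require Import Defs.
From Stdlib Require Import List Arith Lia.
Import ListNotations.
Local Open Scope form_scope.

(** * Calculus of renamings *)

(** A formula has finitely many free variables. The bound [n] later serves to close axioms by
    finitely many quantifiers and to choose fresh variables. *)
Lemma finite_support (A : form) :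
  exists n, forall r s, (forall k, k < n -> r k = s k) -> ren r A = ren s A.
Proof.
  assert (bin : forall (c : form -> form -> form) A B,
    (forall r A B, ren r (c A B) = c (ren r A) (ren r B)) ->
    (exists n, forall r s, (forall k, k < n -> r k = s k) -> ren r A = ren s A) ->
    (exists n, forall r s, (forall k, k < n -> r k = s k) -> ren r B = ren s B) ->
    exists n, forall r s, (forall k, k < n -> r k = s k) ->
      ren r (c A B) = ren s (c A B)).
  { intros c B C Hc [n Hn] [m Hm]. exists (n + m). intros r s H.
    rewrite !Hc. f_equal; [apply Hn | apply Hm]; intros; apply H; lia. }
  assert (quant : forall (q : form -> form) A,
    (forall r A, ren r (q A) = q (ren (0 .: fun n => S (r n)) A)) ->
    (exists n, forall r s, (forall k, k < n -> r k = s k) -> ren r A = ren s A) ->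
    exists n, forall r s, (forall k, k < n -> r k = s k) ->
      ren r (q A) = ren s (q A)).
  (* The bound for the body also serves outside: index [S k] under the binder is index [k]
     outside. *)
  { intros q B Hq [n Hn]. exists n. intros r s H. rewrite !Hq. f_equal.
    apply Hn. intros [|k] Hk; cbn; [easy |]. f_equal. apply H. lia. }
  induction A as [i j|i j| |A IHA B IHB|A IHA B IHB|A IHA B IHB|A IHA|A IHA];
    auto.
  1, 2: exists (S (i + j)); intros r s H; cbn; f_equal; apply H; lia.
  exists 0. easy.
Qed.

Lemma finite_support_list (G : list form) :
  exists n, forall r s, (forall k, k < n -> r k = s k) ->
    map (ren r) G = map (ren s) G.
Proof.
  induction G as [|A G [n Hn]]; [now exists 0 |].
  destruct (finite_support A) as [m Hm]. exists (n + m). intros r s H. cbn.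
  f_equal; [apply Hm | apply Hn]; intros; apply H; lia.
Qed.

(** Takes the place of functional extensionality under binders. *)
Lemma ren_ext r s A : (forall k, r k = s k) -> ren r A = ren s A.
Proof. intros H. destruct (finite_support A) as [n Hn]. now apply Hn. Qed.

Lemma ren_comp r s A : ren r (ren s A) = ren (fun k => r (s k)) A.
Proof.
  revert r s.
  induction A as [i j|i j| |A IHA B IHB|A IHA B IHB|A IHA B IHB|A IHA|A IHA];
    intros r s; cbn; rewrite ?IHA, ?IHB; try easy;
    f_equal; apply ren_ext; now intros [|k].
Qed.

Lemma ren_id A : ren (fun k => k) A = A.
Proof.
  induction A as [i j|i j| |A IHA B IHB|A IHA B IHB|A IHA B IHB|A IHA|A IHA];
    cbn; try congruence; rewrite <- IHA at 2; f_equal; apply ren_ext;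
    now intros [|k].
Qed.

Lemma ren_inst r i A :
  ren r (inst i A) = inst (r i) (ren (0 .: fun n => S (r n)) A).
Proof.
  unfold inst. rewrite !ren_comp. apply ren_ext. now intros [|k].
Qed.

Lemma ren_lift r A : ren (0 .: fun n => S (r n)) (lift A) = lift (ren r A).
Proof. unfold lift. now rewrite !ren_comp. Qed.

(** * Admissible rules: weakening, renaming, and quantifier rules without lifting *)

Lemma weakening T G D A : incl G D -> T;; G ⊢ A -> T;; D ⊢ A.
Proof.
  intros HD H. revert D HD.
  assert (cons : forall (B : form) D D', incl D D' -> incl (B :: D) (B :: D')).
  { intros B D1 D2 HD x [<-|Hx]; [now left | right; auto]. }
  induction H; intros D HD;
    [apply Axm | apply Hyp | apply BotE | apply AndI | eapply AndE1
    | eapply AndE2 | apply OrI1 | apply OrI2 | eapply OrE | apply ImpI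
    | eapply ImpE | apply AllI | apply AllE | eapply ExI | eapply ExE
    | apply EqRefl | eapply EqSubst]; eauto using incl_map.
Qed.

(** [T] need not be closed under renaming: [A] is generalised over all its free
    variables, then instantiated. *)
Lemma axiom_ren T G A r : T A -> T;; G ⊢ (ren r A).
Proof.
  intros HA. destruct (finite_support A) as [n Hn].
  (* [B] is required in every context because each [AllI] lifts the context. *)
  assert (close : forall m B G, (forall G, T;; G ⊢ B) ->
    T;; G ⊢ (Nat.iter m All B)).
  { induction m; cbn; intros B D HB; [apply HB | apply AllI, IHm, HB]. }
  assert (open : forall l B, T;; G ⊢ (Nat.iter (length l) All B) ->
    T;; G ⊢ (ren (fold_right scons (fun k => k) l) B)).
  { induction l as [|i l IH]; intros B HB.
    - cbn. now rewrite ren_id.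
    - cbn [length] in HB. rewrite Nat.iter_succ_r in HB.
      apply IH in HB. cbn in HB. apply AllE with (i := i) in HB.
      unfold inst in HB. rewrite ren_comp in HB.
      erewrite ren_ext; [exact HB |]. now intros [|k]. }
  specialize (open (map r (seq 0 n)) A). rewrite length_map, length_seq in open.
  rewrite (Hn r (fold_right scons (fun k => k) (map r (seq 0 n)))).
  - apply open, close. intros D. now apply Axm.
  - intros k Hk. clear - Hk.
    (* The starting point of [seq] must vary for the induction to go through. *)
    replace (r k) with (r (0 + k)) by easy.
    generalize 0 as a. revert k Hk.
    induction n as [|n IH]; intros k Hk a; [lia |].
    destruct k as [|k]; cbn; [f_equal; lia |].
    rewrite <- (IH k ltac:(lia) (S a)). f_equal. lia.
Qed.

(** Axioms are the one case that induction and commutation of renamings do not settle; there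
    [axiom_ren] steps in. *)
Lemma prv_ren T G A r : T;; G ⊢ A -> T;; map (ren r) G ⊢ (ren r A).
Proof.
  intros H. revert r.
  assert (map_lift : forall r G,
    map (ren (0 .: fun n => S (r n))) (map lift G) = map lift (map (ren r) G)).
  { intros r D. rewrite !map_map. apply map_ext. intros. apply ren_lift. }
  induction H; intros r; cbn in *;
    [now apply axiom_ren | apply Hyp | apply BotE | apply AndI | eapply AndE1
    | eapply AndE2 | apply OrI1 | apply OrI2 | eapply OrE | apply ImpI
    | eapply ImpE | | | | | apply EqRefl | ]; eauto using in_map.
  - apply AllI. rewrite <- map_lift. apply IHprv.
  - rewrite ren_inst. apply AllE, IHprv.
  - eapply ExI. rewrite <- ren_inst. apply IHprv.
  - eapply ExE; [apply IHprv1 |]. rewrite <- map_lift, <- ren_lift. apply IHprv2.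
  - rewrite ren_inst. eapply EqSubst; [apply IHprv1 |].
    rewrite <- ren_inst. apply IHprv2.
Qed.

(** Quantification over all [n] subsumes a fresh eigenvariable, and leaves the
    context unlifted. *)
Lemma all_intro T G A : (forall n, T;; G ⊢ (inst n A)) -> T;; G ⊢ (All A).
Proof.
  intros H.
  destruct (finite_support_list G) as [n Hn], (finite_support A) as [m Hm].
  (* [n + m] is fresh for [G] and [A]. Sending it to [0] and shifting all else turns the derivation
     for this variable into the premise of [AllI]. *)
  set (r := fun k => if k =? n + m then 0 else S k).
  assert (Hr : forall k, k < n + m -> r k = S k).
  { intros k Hk. unfold r. now rewrite (proj2 (Nat.eqb_neq k (n + m))) by lia. }
  apply AllI. generalize (prv_ren _ _ _ r (H (n + m))).
  rewrite (Hn r S) by (intros; apply Hr; lia).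
  unfold inst. rewrite ren_comp, (Hm _ (fun k => k)), ren_id; [easy |].
  intros [|k] Hk; cbn.
  - unfold r. now rewrite Nat.eqb_refl.
  - apply Hr. lia.
Qed.

(** The premise has Kripke form: a hypothesis becomes a derivability assumption over an arbitrary
    larger context. *)
Lemma imp_intro T G A B :
  (forall D, incl G D -> T;; D ⊢ A -> T;; D ⊢ B) -> T;; G ⊢ (A --> B).
Proof.
  intros H. apply ImpI, H; [now apply incl_tl | now apply Hyp; left].
Qed.

Lemma ex_elim T G A C : T;; G ⊢ (Ex A) ->
  (forall n D, incl G D -> T;; D ⊢ (inst n A) -> T;; D ⊢ C) -> T;; G ⊢ C.
Proof.
  intros HA H.
  assert (HC : T;; G ⊢ All (A --> lift C)).
  { apply all_intro. intros n. change (T;; G ⊢ (inst n A --> inst n (lift C))).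
    unfold inst at 2, lift. rewrite ren_comp. cbn. rewrite ren_id.
    apply imp_intro, H. }
  apply (ExE _ _ _ _ HA).
  (* Lifting [HC] and instantiating it at the eigenvariable [0] gives [A --> lift C] in the lifted
     context, as [ExE] requires. *)
  apply (prv_ren _ _ _ S) in HC. cbn in HC.
  apply AllE with (i := 0) in HC. cbn in HC.
  apply ImpE with A.
  - eapply weakening; [apply incl_tl, incl_refl |].
    cbn in HC. unfold inst in HC. cbn in HC.
    rewrite (ren_comp _ _ A), (ren_comp _ _ (lift C)) in HC.
    replace (lift C) with (ren (fun k => k) (lift C)) by apply ren_id.
    replace A with (ren (fun k => k) A) by apply ren_id.
    erewrite (ren_ext _ _ A), (ren_ext _ _ (lift C)); [exact HC | |];
      now intros [|k].
  - now apply Hyp; left.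
Qed.

Lemma or_elim T G A B C : T;; G ⊢ (A \/ B) ->
  (forall D, incl G D -> T;; D ⊢ A -> T;; D ⊢ C) ->
  (forall D, incl G D -> T;; D ⊢ B -> T;; D ⊢ C) -> T;; G ⊢ C.
Proof.
  intros H HA HB. apply OrE with A B; [easy | apply HA | apply HB];
    (now apply incl_tl) || now apply Hyp; left.
Qed.

Notation "G ⊩ A" := (prv (extend CZF0 GUP) G A) (at level 75, A at level 74).

(** All hypotheses move to the larger context, which takes over the old name. *)
Ltac move_along I :=
  match type of I with
  | incl ?G ?D =>
      repeat match goal with
      | H : prv _ G _ |- _ => apply (weakening _ _ _ _ I) in H
      end; clear I; clear G; rename D into G
  end.

Tactic Notation "all_in" ident(n) := apply all_intro; intros n.
Tactic Notation "imp_in" ident(H) :=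
  apply imp_intro; let D := fresh "D" in let I := fresh "I" in
  intros D I H; move_along I.
Tactic Notation "ball_in" ident(n) ident(H) := all_in n; imp_in H.
Tactic Notation "ex_in" uconstr(E) "as" ident(n) ident(H) :=
  refine (ex_elim _ _ _ _ E _); let D := fresh "D" in let I := fresh "I" in
  intros n D I H; move_along I.
Tactic Notation "bex_in" uconstr(E) "as" ident(n) ident(H) ident(K) :=
  ex_in E as n H; pose proof (AndE2 _ _ _ _ H) as K; apply AndE1 in H.
Tactic Notation "or_in" uconstr(E) "as" ident(H) :=
  refine (or_elim _ _ _ _ _ E _ _); let D := fresh "D" in let I := fresh "I" in
  intros D I H; move_along I.
Tactic Notation "witness" constr(i) := apply (ExI _ _ _ i).

(** * Derived rules for equivalence, bounded quantifiers and equality *)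

Lemma iff_elim1 T G A B : T;; G ⊢ (A <-> B) -> T;; G ⊢ A -> T;; G ⊢ B.
Proof. intros H. apply ImpE, (AndE1 _ _ _ _ H). Qed.

Lemma iff_elim2 T G A B : T;; G ⊢ (A <-> B) -> T;; G ⊢ B -> T;; G ⊢ A.
Proof. intros H. apply ImpE, (AndE2 _ _ _ _ H). Qed.

Lemma ball_elim T G a A B i :
  T;; G ⊢ (BAll a A) -> T;; G ⊢ (i ∈ a) -> inst i A = B -> T;; G ⊢ B.
Proof. intros H Hi <-. exact (ImpE _ _ _ _ (AllE _ _ _ i H) Hi). Qed.

Lemma eq_sym T G x y : T;; G ⊢ (x ≐ y) -> T;; G ⊢ (y ≐ x).
Proof. intros H. exact (EqSubst _ _ _ _ (0 ≐ S x) H (EqRefl _ _ _)). Qed.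

Lemma eq_trans T G x y z :
  T;; G ⊢ (x ≐ y) -> T;; G ⊢ (y ≐ z) -> T;; G ⊢ (x ≐ z).
Proof. intros H K. exact (EqSubst _ _ _ _ (S x ≐ 0) K H). Qed.

Lemma eq_mem_l T G x y a :
  T;; G ⊢ (x ≐ y) -> T;; G ⊢ (x ∈ a) -> T;; G ⊢ (y ∈ a).
Proof. intros H K. exact (EqSubst _ _ _ _ (0 ∈ S a) H K). Qed.

Lemma opair_eq1 T G p q x y :
  T;; G ⊢ (p ≐ q) -> T;; G ⊢ (opair p x y) -> T;; G ⊢ (opair q x y).
Proof. intros H K. exact (EqSubst _ _ _ _ (opair 0 (S x) (S y)) H K). Qed.

Lemma opair_eq2 T G p x x' y :
  T;; G ⊢ (x ≐ x') -> T;; G ⊢ (opair p x y) -> T;; G ⊢ (opair p x' y).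
Proof. intros H K. exact (EqSubst _ _ _ _ (opair (S p) 0 (S y)) H K). Qed.

Lemma opair_eq3 T G p x y y' :
  T;; G ⊢ (y ≐ y') -> T;; G ⊢ (opair p x y) -> T;; G ⊢ (opair p x y').
Proof. intros H K. exact (EqSubst _ _ _ _ (opair (S p) (S x) 0) H K). Qed.

(** * Singletons, unordered pairs and Kuratowski pairs *)

Lemma singleton_elim T G p x z :
  T;; G ⊢ (singleton p x) -> T;; G ⊢ (z ∈ p) -> T;; G ⊢ (z ≐ x).
Proof. intros H. exact (iff_elim1 _ _ _ _ (AllE _ _ _ z H)). Qed.

Lemma singleton_intro T G p x : T;; G ⊢ (singleton p x) -> T;; G ⊢ (x ∈ p).
Proof. intros H. exact (iff_elim2 _ _ _ _ (AllE _ _ _ x H) (EqRefl _ _ _)). Qed.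

Lemma upair_elim T G p x y z :
  T;; G ⊢ (upair p x y) -> T;; G ⊢ (z ∈ p) -> T;; G ⊢ (z ≐ x \/ z ≐ y).
Proof. intros H. exact (iff_elim1 _ _ _ _ (AllE _ _ _ z H)). Qed.

Lemma upair_intro1 T G p x y : T;; G ⊢ (upair p x y) -> T;; G ⊢ (x ∈ p).
Proof.
  intros H. apply (iff_elim2 _ _ _ _ (AllE _ _ _ x H)). apply OrI1, EqRefl.
Qed.

Lemma upair_intro2 T G p x y : T;; G ⊢ (upair p x y) -> T;; G ⊢ (y ∈ p).
Proof.
  intros H. apply (iff_elim2 _ _ _ _ (AllE _ _ _ y H)). apply OrI2, EqRefl.
Qed.

Lemma opair_elim T G p x y z : T;; G ⊢ (opair p x y) -> T;; G ⊢ (z ∈ p) ->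
  T;; G ⊢ (singleton z x \/ upair z x y).
Proof. intros H. exact (iff_elim1 _ _ _ _ (AllE _ _ _ z H)). Qed.

Lemma opair_intro1 T G p x y z :
  T;; G ⊢ (opair p x y) -> T;; G ⊢ (singleton z x) -> T;; G ⊢ (z ∈ p).
Proof.
  intros H K. apply (iff_elim2 _ _ _ _ (AllE _ _ _ z H)). now apply OrI1.
Qed.

Lemma opair_intro2 T G p x y z :
  T;; G ⊢ (opair p x y) -> T;; G ⊢ (upair z x y) -> T;; G ⊢ (z ∈ p).
Proof.
  intros H K. apply (iff_elim2 _ _ _ _ (AllE _ _ _ z H)). now apply OrI2.
Qed.

(** [singleton], [upair] and [opair] all unfold to this shape, so extensionality gives uniqueness
    for each of them at once. *)
Lemma comprehension_unique G B x y :
  G ⊩ (All (0 ∈ S x <-> B)) -> G ⊩ (All (0 ∈ S y <-> B)) -> G ⊩ (x ≐ y).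
Proof.
  intros Hx Hy.
  assert (E : G ⊩ extensionality) by (apply Axm; left; constructor).
  apply AllE with (i := x), AllE with (i := y) in E.
  apply (ImpE _ _ _ _ E). all_in z.
  apply AllE with (i := z) in Hx, Hy.
  apply AndI; imp_in K.
  - apply (iff_elim2 _ _ _ _ Hy), (iff_elim1 _ _ _ _ Hx), K.
  - apply (iff_elim2 _ _ _ _ Hx), (iff_elim1 _ _ _ _ Hy), K.
Qed.

Lemma upair_exists G x y : G ⊩ (Ex (upair 0 (S x) (S y))).
Proof.
  assert (E : G ⊩ pairing) by (apply Axm; left; constructor).
  exact (AllE _ _ _ y (AllE _ _ _ x E)).
Qed.

Lemma singleton_exists G x : G ⊩ (Ex (singleton 0 (S x))).
Proof.
  ex_in (upair_exists G x x) as p H. witness p. all_in z. apply AndI; imp_in K.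
  - or_in (upair_elim _ _ _ _ _ _ H K) as L; exact L.
  - eapply eq_mem_l; [apply eq_sym, K | eapply upair_intro1, H].
Qed.

Lemma opair_exists G x y : G ⊩ (Ex (opair 0 (S x) (S y))).
Proof.
  ex_in (singleton_exists G x) as s Hs. ex_in (upair_exists _ x y) as u Hu.
  ex_in (upair_exists _ s u) as p Hp. witness p. all_in z. apply AndI; imp_in K.
  - or_in (upair_elim _ _ _ _ _ _ Hp K) as L; apply eq_sym in L.
    + apply OrI1. exact (EqSubst _ _ _ _ (singleton 0 (S x)) L Hs).
    + apply OrI2. exact (EqSubst _ _ _ _ (upair 0 (S x) (S y)) L Hu).
  - or_in K as L.
    + eapply eq_mem_l; [eapply comprehension_unique; [exact Hs | exact L] |].
      eapply upair_intro1, Hp.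
    + eapply eq_mem_l; [eapply comprehension_unique; [exact Hu | exact L] |].
      eapply upair_intro2, Hp.
Qed.

(** The set {a} belongs to [p], hence is {c} or {c, d}; either way [c] lies in {a}. *)
Lemma opair_inj1 G p a b c d :
  G ⊩ (opair p a b) -> G ⊩ (opair p c d) -> G ⊩ (a ≐ c).
Proof.
  intros H K. ex_in (singleton_exists G a) as s Hs.
  apply eq_sym, (singleton_elim _ _ _ _ _ Hs).
  or_in (opair_elim _ _ _ _ _ _ K (opair_intro1 _ _ _ _ _ _ H Hs)) as L.
  - apply (singleton_intro _ _ _ _ L).
  - apply (upair_intro1 _ _ _ _ _ L).
Qed.

(** Once [c] is replaced by [a], compare {a, b} with {a, d}. Every case distinction comes from
    membership in a pair, so equality is never decided. *)
Lemma opair_inj2 G p a b c d :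
  G ⊩ (opair p a b) -> G ⊩ (opair p c d) -> G ⊩ (b ≐ d).
Proof.
  intros H K.
  apply (opair_eq2 _ _ _ _ _ _ (eq_sym _ _ _ _ (opair_inj1 _ _ _ _ _ _ H K))) in K.
  ex_in (upair_exists G a b) as u Hu. ex_in (upair_exists _ a d) as v Hv.
  or_in (opair_elim _ _ _ _ _ _ K (opair_intro2 _ _ _ _ _ _ H Hu)) as L.
  - pose proof (singleton_elim _ _ _ _ _ L (upair_intro2 _ _ _ _ _ Hu)) as E.
    or_in (opair_elim _ _ _ _ _ _ H (opair_intro2 _ _ _ _ _ _ K Hv)) as M.
    + apply (eq_trans _ _ _ _ _ E), eq_sym, (singleton_elim _ _ _ _ _ M).
      apply (upair_intro2 _ _ _ _ _ Hv).
    + or_in (upair_elim _ _ _ _ _ _ M (upair_intro2 _ _ _ _ _ Hv)) as N.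
      * apply (eq_trans _ _ _ _ _ E), eq_sym, N.
      * apply eq_sym, N.
  - or_in (upair_elim _ _ _ _ _ _ Hu (upair_intro2 _ _ _ _ _ L)) as M.
    + or_in (upair_elim _ _ _ _ _ _ L (upair_intro2 _ _ _ _ _ Hu)) as N.
      * apply (eq_trans _ _ _ _ _ N), eq_sym, M.
      * exact N.
    + apply eq_sym, M.
Qed.

(** * Maps as sets of pairs *)

(** The separate [B] lets the instance be given in substituted form; the equation then holds by
    computation. *)
Lemma bex_intro T G a A i B :
  inst i A = B -> T;; G ⊢ (i ∈ a) -> T;; G ⊢ B -> T;; G ⊢ (BEx a A).
Proof. intros <- H K. exact (ExI _ _ (0 ∈ S a /\ A) i (AndI _ _ _ _ H K)). Qed.

Lemma sends_intro T G f p x y :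
  T;; G ⊢ (p ∈ f) -> T;; G ⊢ (opair p x y) -> T;; G ⊢ (sends f x y).
Proof. apply bex_intro. reflexivity. Qed.

(** [is_map] bounds values by [e] only through the members of [f]. The value provided by unique
    existence is therefore matched, by injectivity of pairing, with a second component lying in
    [e]. *)
Lemma is_map_total G f x e u :
  G ⊩ (is_map f x e) -> G ⊩ (u ∈ x) ->
  G ⊩ (BEx e (sends (S f) (S u) 0)).
Proof.
  intros H Hu.
  ex_in (ball_elim _ _ _ _ _ u (AndE2 _ _ _ _ H) Hu eq_refl) as v K.
  apply AndE1 in K. bex_in K as p Hp L.
  bex_in (ball_elim _ _ _ _ _ p (AndE1 _ _ _ _ H) Hp eq_refl) as u' Hu' M.
  bex_in M as v' Hv N.
  apply bex_intro with (i := v') (B := sends f u v'); [reflexivity | exact Hv |].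
  apply sends_intro with p; [exact Hp |].
  exact (opair_eq3 _ _ _ _ _ _ (opair_inj2 _ _ _ _ _ _ L N) L).
Qed.

Lemma is_map_functional G f x e u v w :
  G ⊩ (is_map f x e) -> G ⊩ (u ∈ x) ->
  G ⊩ (sends f u v) -> G ⊩ (sends f u w) -> G ⊩ (v ≐ w).
Proof.
  intros H Hu Hv Hw.
  ex_in (ball_elim _ _ _ _ _ u (AndE2 _ _ _ _ H) Hu eq_refl) as t K.
  apply AndE2 in K.
  apply eq_trans with t; [| apply eq_sym].
  - exact (ImpE _ _ _ _ (AllE _ _ _ v K) Hv).
  - exact (ImpE _ _ _ _ (AllE _ _ _ w K) Hw).
Qed.

Lemma is_map_intro T G f x e :
  (forall D z, incl G D -> T;; D ⊢ (z ∈ f) ->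
    T;; D ⊢ (BEx x (BEx (S e) (opair (2 + z) 1 0)))) ->
  (forall D u, incl G D -> T;; D ⊢ (u ∈ x) ->
    T;; D ⊢ (Ex (sends (S f) (S u) 0 /\ All (sends (2 + f) (2 + u) 0 --> 0 ≐ 1)))) ->
  T;; G ⊢ (is_map f x e).
Proof.
  intros H K. apply AndI; apply all_intro; intros i; apply imp_intro; intros D I.
  - exact (H D i I).
  - exact (K D i I).
Qed.

(** * Sets given by separation and replacement *)

Lemma separation_instance G a A : Delta0 A -> G ⊩ (separation a A).
Proof. intros H. apply Axm. left. now constructor. Qed.

Lemma replacement_instance G a A : G ⊩ (BAll a (ExUniq A)) ->
  G ⊩ (Ex (All (0 ∈ 1 <-> BEx (2 + a) (ren (1 .: 0 .: fun n => 3 + n) A)))).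
Proof.
  intros H. refine (ImpE _ _ _ _ _ H). apply Axm. left. exact (CZF0_repl a A).
Qed.

Lemma empty_elim T G o x A : T;; G ⊢ (empty o) -> T;; G ⊢ (x ∈ o) -> T;; G ⊢ A.
Proof. intros H K. exact (BotE _ _ _ (ImpE _ _ _ _ (AllE _ _ _ x H) K)). Qed.

Lemma empty_exists G : G ⊩ (Ex (empty 0)).
Proof.
  (* The free variable [0] stands for an arbitrary set to separate from. *)
  ex_in (separation_instance _ 0 Bot D0Bot) as o H. witness o. all_in x.
  imp_in K. apply AllE with (i := x) in H.
  exact (AndE2 _ _ _ _ (iff_elim1 _ _ _ _ H K)).
Qed.

(** Replacement along the assignment of the pair (y, s) to [y]. *)
Lemma constant_map_exists G x s :
  G ⊩ (Ex (All (0 ∈ 1 <-> BEx (2 + x) (opair 1 0 (3 + s))))).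
Proof.
  apply (replacement_instance G x (opair 0 1 (2 + s))).
  ball_in y Hy. ex_in (opair_exists _ y s) as p Hp. witness p.
  apply AndI; [exact Hp |]. all_in q. imp_in Hq.
  exact (comprehension_unique _ _ _ _ Hq Hp).
Qed.

(** * Singletons are injective *)

(** The constant map on [Y] with value [s] extends [f], whose values can only be [s]. *)
Lemma singleton_injective G e s : G ⊩ (singleton e s) -> G ⊩ (injective e).
Proof.
  intros He. all_in X. all_in Y. imp_in HXY. all_in f. imp_in Hf.
  ex_in (constant_map_exists _ Y s) as g Hg.
  witness g. apply AndI.
  - apply is_map_intro; intros D' i I Hi; move_along I.
    + bex_in (iff_elim1 _ _ _ _ (AllE _ _ _ i Hg) Hi) as y Hy Hp.
      apply bex_intro with y (BEx e (opair (S i) (S y) 0)); [reflexivity | exact Hy |].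
      apply bex_intro with s (opair i y s); [reflexivity | | exact Hp].
      exact (singleton_intro _ _ _ _ He).
    + witness s. apply AndI.
      * ex_in (opair_exists _ i s) as p Hp. apply sends_intro with p; [| exact Hp].
        apply (iff_elim2 _ _ _ _ (AllE _ _ _ p Hg)).
        now apply bex_intro with i (opair p i s).
      * all_in v. imp_in Hv. bex_in Hv as p Hpg Hp.
        bex_in (iff_elim1 _ _ _ _ (AllE _ _ _ p Hg) Hpg) as y Hy Hq.
        exact (opair_inj2 _ _ _ _ _ _ Hp Hq).
  - all_in z. apply AndI; imp_in Hz.
    + bex_in (ball_elim _ _ _ _ _ z (AndE1 _ _ _ _ Hf) Hz eq_refl) as x Hx K.
      bex_in K as v Hv Hp. apply AndI.
      * apply (iff_elim2 _ _ _ _ (AllE _ _ _ z Hg)).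
        apply bex_intro with x (opair z x s); [reflexivity | |].
        -- exact (ball_elim _ _ _ _ _ x HXY Hx eq_refl).
        -- exact (opair_eq3 _ _ _ _ _ _ (singleton_elim _ _ _ _ _ He Hv) Hp).
      * apply bex_intro with x (Ex (opair (S z) (S x) 0)); [reflexivity | exact Hx |].
        witness v. exact Hp.
    (* A pair of [g] over some [x] in [X] is (x, s). Totality of [f] at [x] yields a pair in [f]
       that is also (x, s), hence the same set. *)
    + pose proof (AndE1 _ _ _ _ Hz) as Hzg. apply AndE2 in Hz.
      bex_in (iff_elim1 _ _ _ _ (AllE _ _ _ z Hg) Hzg) as y Hy Hp.
      bex_in Hz as x Hx K. ex_in K as v Hq.
      bex_in (is_map_total _ _ _ _ x Hf Hx) as w Hw L.
      bex_in L as q Hqf Hr.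
      refine (eq_mem_l _ _ _ _ _ _ Hqf).
      apply (opair_eq3 _ _ _ _ _ _ (singleton_elim _ _ _ _ _ He Hw)) in Hr.
      apply (opair_eq2 _ _ _ _ _ _ (opair_inj1 _ _ _ _ _ _ Hp Hq)) in Hp.
      exact (comprehension_unique _ _ _ _ Hr Hp).
Qed.

(** * Injective sets have exactly one element under uniformity *)

Lemma restriction_sends T G f g x u v :
  T;; G ⊢ (is_restriction f g x) -> T;; G ⊢ (sends f u v) -> T;; G ⊢ (sends g u v).
Proof.
  intros H K. bex_in K as p Hp L. apply sends_intro with p; [| exact L].
  exact (AndE1 _ _ _ _ (iff_elim1 _ _ _ _ (AllE _ _ _ p H) Hp)).
Qed.

Lemma injective_extension T G e x y f :
  T;; G ⊢ (injective e) -> T;; G ⊢ (subset x y) -> T;; G ⊢ (is_map f x e) ->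
  T;; G ⊢ (Ex (is_map 0 (S y) (S e) /\ is_restriction (S f) 0 (S x))).
Proof.
  intros H Hxy Hf.
  apply AllE with (i := x), AllE with (i := y) in H.
  pose proof (AllE _ _ _ f (ImpE _ _ _ _ H Hxy)) as K.
  exact (ImpE _ _ _ _ K Hf).
Qed.

Lemma empty_is_map T G o e : T;; G ⊢ (empty o) -> T;; G ⊢ (is_map o o e).
Proof.
  intros H. apply is_map_intro; intros D i I Hi; move_along I;
    exact (empty_elim _ _ _ _ _ H Hi).
Qed.

Lemma empty_subset T G o x : T;; G ⊢ (empty o) -> T;; G ⊢ (subset o x).
Proof. intros H. ball_in y Hy. exact (empty_elim _ _ _ _ _ H Hy). Qed.

Lemma injective_inhabited G e : G ⊩ (injective e) -> G ⊩ (Ex (0 ∈ S e)).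
Proof.
  intros H. ex_in (empty_exists _) as o Ho.
  ex_in (singleton_exists _ o) as t Ht.
  (* The empty set [o] is both the domain and the map to be extended. *)
  ex_in (injective_extension _ _ e o t o H (empty_subset _ _ _ _ Ho)
    (empty_is_map _ _ _ _ Ho)) as g Hg.
  bex_in (is_map_total _ _ _ _ o (AndE1 _ _ _ _ Hg) (singleton_intro _ _ _ _ Ht))
    as v Hv K.
  witness v. exact Hv.
Qed.

(** The domain [X] is the part of {o} on which membership in [x] is decided, and the graph [f] is
    cut out of the two pairs (o, a) and (o, b). Both conditions are quantifier-free, so restricted
    separation applies. *)
Lemma injective_case_value G e a b o x :
  G ⊩ (injective e) -> G ⊩ (a ∈ e) -> G ⊩ (b ∈ e) ->
  G ⊩ (BEx e ((S o ∈ S x --> 0 ≐ S a) /\ (~ S o ∈ S x --> 0 ≐ S b))).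
Proof.
  intros He Ha Hb.
  ex_in (singleton_exists _ o) as t Ht.
  ex_in (opair_exists _ o a) as p Hp. ex_in (opair_exists _ o b) as q Hq.
  ex_in (upair_exists _ p q) as c Hc.
  ex_in (separation_instance _ t (0 ∈ S x \/ ~ 0 ∈ S x) ltac:(repeat constructor))
    as X HX.
  ex_in (separation_instance _ c
    ((0 ≐ S p /\ S o ∈ S x) \/ (0 ≐ S q /\ ~ S o ∈ S x)) ltac:(repeat constructor))
    as f Hf.
  assert (HXt : G ⊩ (subset X t)).
  { ball_in u Hu. pose proof (iff_elim1 _ _ _ _ (AllE _ _ _ u HX) Hu) as K.
    exact (AndE1 _ _ _ _ K). }
  assert (Hpf : G ⊩ (o ∈ x --> sends f o a)).
  { imp_in K. apply sends_intro with p; [| exact Hp].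
    apply (iff_elim2 _ _ _ _ (AllE _ _ _ p Hf)).
    apply AndI; [exact (upair_intro1 _ _ _ _ _ Hc) |].
    apply OrI1, AndI; [apply EqRefl | exact K]. }
  assert (Hqf : G ⊩ (~ o ∈ x --> sends f o b)).
  { imp_in K. apply sends_intro with q; [| exact Hq].
    apply (iff_elim2 _ _ _ _ (AllE _ _ _ q Hf)).
    apply AndI; [exact (upair_intro2 _ _ _ _ _ Hc) |].
    apply OrI2, AndI; [apply EqRefl | exact K]. }
  assert (Hr : G ⊩ (BAll f ((0 ≐ S p /\ S o ∈ S x) \/ (0 ≐ S q /\ ~ S o ∈ S x)))).
  { ball_in r Hr. pose proof (iff_elim1 _ _ _ _ (AllE _ _ _ r Hf) Hr) as K.
    apply AndE2 in K. exact K. }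
  clear Hf.
  assert (HoX : G ⊩ ((o ∈ x \/ ~ o ∈ x) --> o ∈ X)).
  { imp_in K. apply (iff_elim2 _ _ _ _ (AllE _ _ _ o HX)).
    apply AndI; [exact (singleton_intro _ _ _ _ Ht) | exact K]. }
  assert (Hox : G ⊩ (BAll X (0 ≐ S o /\ (S o ∈ S x \/ ~ S o ∈ S x)))).
  { ball_in u Hu. pose proof (iff_elim1 _ _ _ _ (AllE _ _ _ u HX) Hu) as K.
    pose proof (singleton_elim _ _ _ _ _ Ht (AndE1 _ _ _ _ K)) as E.
    apply AndI; [exact E |].
    exact (EqSubst _ _ _ _ (0 ∈ S x \/ ~ 0 ∈ S x) E (AndE2 _ _ _ _ K)). }
  assert (fmap : G ⊩ (is_map f X e)).
  { apply is_map_intro; intros D' i I Hi; move_along I.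
    - pose proof (ball_elim _ _ _ _ _ i Hr Hi eq_refl) as K.
      or_in K as L; pose proof (eq_sym _ _ _ _ (AndE1 _ _ _ _ L)) as E;
        apply AndE2 in L.
      + apply bex_intro with o (BEx e (opair (S i) (S o) 0)); [reflexivity | |].
        * exact (ImpE _ _ _ _ HoX (OrI1 _ _ _ _ L)).
        * apply bex_intro with a (opair i o a); [reflexivity | exact Ha |].
          exact (opair_eq1 _ _ _ _ _ _ E Hp).
      + apply bex_intro with o (BEx e (opair (S i) (S o) 0)); [reflexivity | |].
        * exact (ImpE _ _ _ _ HoX (OrI2 _ _ _ _ L)).
        * apply bex_intro with b (opair i o b); [reflexivity | exact Hb |].
          exact (opair_eq1 _ _ _ _ _ _ E Hq).
    - pose proof (ball_elim _ _ _ _ _ i Hox Hi eq_refl) as K.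
      (* As [i] equals [o], unique existence of the value need only be shown at [o]. *)
      refine (EqSubst _ _ _ _ (Ex (sends (2 + f) 1 0 /\
        All (sends (3 + f) 2 0 --> 0 ≐ 1))) (eq_sym _ _ _ _ (AndE1 _ _ _ _ K)) _).
      apply AndE2 in K. or_in K as L.
      + witness a. apply AndI; [exact (ImpE _ _ _ _ Hpf L) |].
        all_in v. imp_in Hv. bex_in Hv as r Hrf N.
        (* The pair [r] is [p] or [q]; the case of [q] contradicts [L]. *)
        or_in (ball_elim _ _ _ _ _ r Hr Hrf eq_refl) as M.
        * exact (opair_inj2 _ _ _ _ _ _ N
            (opair_eq1 _ _ _ _ _ _ (eq_sym _ _ _ _ (AndE1 _ _ _ _ M)) Hp)).
        * exact (BotE _ _ _ (ImpE _ _ _ _ (AndE2 _ _ _ _ M) L)).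
      + witness b. apply AndI; [exact (ImpE _ _ _ _ Hqf L) |].
        all_in v. imp_in Hv. bex_in Hv as r Hrf N.
        or_in (ball_elim _ _ _ _ _ r Hr Hrf eq_refl) as M.
        * exact (BotE _ _ _ (ImpE _ _ _ _ L (AndE2 _ _ _ _ M))).
        * exact (opair_inj2 _ _ _ _ _ _ N
            (opair_eq1 _ _ _ _ _ _ (eq_sym _ _ _ _ (AndE1 _ _ _ _ M)) Hq)). }
  ex_in (injective_extension _ _ _ _ _ _ He HXt fmap) as g Hg.
  pose proof (AndE2 _ _ _ _ Hg) as Hres. apply AndE1 in Hg.
  pose proof (singleton_intro _ _ _ _ Ht) as Hot.
  bex_in (is_map_total _ _ _ _ o Hg Hot) as v Hv Hgv.
  apply bex_intro with v ((o ∈ x --> v ≐ a) /\ (~ o ∈ x --> v ≐ b));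
    [reflexivity | exact Hv |].
  (* In either case [g] also sends [o] to the value that [f] prescribes, so functionality of [g]
     identifies it with [v]. *)
  apply AndI; imp_in K; apply (is_map_functional _ _ _ _ _ _ _ Hg Hot Hgv);
    apply (restriction_sends _ _ _ _ _ _ _ Hres).
  - exact (ImpE _ _ _ _ Hpf K).
  - exact (ImpE _ _ _ _ Hqf K).
Qed.

Lemma injective_subsingleton G e a b :
  G ⊩ (injective e) -> G ⊩ (a ∈ e) -> G ⊩ (b ∈ e) -> G ⊩ (a ≐ b).
Proof.
  intros He Ha Hb. ex_in (empty_exists _) as o Ho.
  ex_in (singleton_exists _ o) as t Ht.
  (* Variable [0] is the value y, variable [1] the set x ranging over the universe; the parameters
     are shifted by two. *)
  set (A := (S (S o) ∈ 1 --> 0 ≐ S (S a)) /\ (~ S (S o) ∈ 1 --> 0 ≐ S (S b))).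
  assert (U : G ⊩ (uniformity e A)) by (apply Axm; right; constructor).
  assert (P : G ⊩ (All (BEx (S e) A))).
  { apply all_intro. intros x. exact (injective_case_value _ _ _ _ o x He Ha Hb). }
  bex_in (ImpE _ _ _ _ U P) as y Hy K.
  apply eq_trans with y; [apply eq_sym |].
  - refine (ImpE _ _ _ _ (AndE1 _ _ _ _ (AllE _ _ _ t K)) _).
    exact (singleton_intro _ _ _ _ Ht).
  - refine (ImpE _ _ _ _ (AndE2 _ _ _ _ (AllE _ _ _ o K)) _).
    exact (AllE _ _ _ o Ho).
Qed.

Theorem theorem9 :
  provable (extend CZF0 GUP)
    (All (Iff (injective 0) (Ex (singleton 1 0)))).
Proof.
  (* The context must be a variable, since each step replaces it by a larger one of the same
     name. *)
  unfold provable. generalize (@nil form). intros G.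
  all_in e. apply AndI; imp_in H.
  - ex_in (injective_inhabited _ _ H) as s Hs. witness s. all_in z.
    apply AndI; imp_in K.
    + exact (injective_subsingleton _ _ _ _ H K Hs).
    + exact (eq_mem_l _ _ _ _ _ (eq_sym _ _ _ _ K) Hs).
  - ex_in H as s Hs. exact (singleton_injective _ _ _ Hs).
Qed.
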